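(* Let $\gamma_k>0$ and $\sigma>0$ with $\gamma_k\sigma>\epsilon$ for some $\epsilon>0$. Let $B_0=\gamma_k^{-1}I$, let $B_1,\dots,B_k$ ($k\ge 1$) be the L-BFGS quasi-Newton matrices generated from $B_0$ by the pairs $(s_0,y_0),\dots,(s_{k-1},y_{k-1})$, with associated vectors $a_i,b_i$, as defined in the context. Let $C_0=(\gamma_k^{-1}+\sigma)I$ and, for $j=0,\dots,2k-1$, let $C_{j+1}=C_0+E_0+\cdots+E_j$, where $E_{2i}=-a_ia_i^T$ and $E_{2i+1}=b_ib_i^T$ for $i=0,\dots,k-1$ (so that $C_{2k}=B_k+\sigma I$). For $j=0,\dots,2k-1$ let $c_j=a_{j/2}$ if $j$ is even and $c_j=b_{(j-1)/2}$ if $j$ is odd, and define $$p_j=C_j^{-1}c_j,\qquad v_j=\frac{1}{1-p_j^Ta_{j/2}}\ \text{ if } j \text{ is even},\qquad v_j=\frac{1}{1+p_j^Tb_{(j-1)/2}}\ \text{ if } j\text{ is odd}.$$ Then for every $z\in\mathbb{R}^n$ and every $m=0,\dots,2k-1$, $$C_{m+1}^{-1}z=C_0^{-1}z+\sum_{i=0}^{m}(-1)^i v_i\,(p_i^Tz)\,p_i,\qquad C_0^{-1}z=(\gamma_k^{-1}+\sigma)^{-1}z,$$ and the vectors $p_m$, $m=0,\dots,2k-1$, can be computed recursively by $$p_m=C_0^{-1}c_m+\sum_{i=0}^{m-1}(-1)^iv_i\,(p_i^Tc_m)\,p_i .$$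
   Context: All matrices are real $n\times n$ and all vectors lie in $\mathbb{R}^n$. Given $B_0=\gamma_k^{-1}I$ and vector pairs $(s_i,y_i)$, $i=0,\dots,k-1$, the L-BFGS matrices are defined recursively for $j=1,\dots,k$ by $$B_j=B_0-\sum_{i=0}^{j-1}a_ia_i^T+\sum_{i=0}^{j-1}b_ib_i^T,\qquad a_i=\frac{B_is_i}{\sqrt{s_i^TB_is_i}},\qquad b_i=\frac{y_i}{\sqrt{y_i^Ts_i}}.$$ Standing assumption: the updates are chosen so that these vectors are well defined (in particular $s_i\neq 0$ and $y_i^Ts_i>0$ for all $i$) and all the matrices $B_0,B_1,\dots,B_k$ are positive definite. Empty sums are zero. *)

(* Defs.v *)
From mathcomp Require Import all_boot all_order all_algebra.
From mathcomp Require Import reals.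

Set Implicit Arguments.
Unset Strict Implicit.
Unset Printing Implicit Defensive.

Import Order.TTheory GRing.Theory Num.Theory.
Local Open Scope ring_scope.

Definition dotv (R : realType) (n : nat) (u v : 'cV[R]_n) : R :=
  (u^T *m v) 0 0.

Definition posdef (R : realType) (n : nat) (A : 'M[R]_n) : Prop :=
  A^T = A /\ forall x : 'cV[R]_n, x != 0 -> 0 < dotv x (A *m x).

Definition lbfgs_a (R : realType) (n : nat) (B : nat -> 'M[R]_n)
    (s : nat -> 'cV[R]_n) (i : nat) : 'cV[R]_n :=
  (Num.sqrt (dotv (s i) (B i *m s i)))^-1 *: (B i *m s i).

Definition lbfgs_b (R : realType) (n : nat)
    (s y : nat -> 'cV[R]_n) (i : nat) : 'cV[R]_n :=
  (Num.sqrt (dotv (y i) (s i)))^-1 *: y i.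

(* [B 0], ..., [B k] are determined by this predicate, since [lbfgs_a B s i]
   only involves [B i]; the values of [B] beyond [k], and those of [s] and [y]
   from [k] on, are irrelevant. *)
Definition lbfgs_matrices (R : realType) (n k : nat) (gamma : R)
    (s y : nat -> 'cV[R]_n) (B : nat -> 'M[R]_n) : Prop :=
  B 0%N = (gamma^-1)%:M /\
  forall j : nat, (1 <= j <= k)%N ->
    B j = B 0%N - \sum_(i < j) lbfgs_a B s i *m (lbfgs_a B s i)^T
                + \sum_(i < j) lbfgs_b s y i *m (lbfgs_b s y i)^T.

Definition seqc (R : realType) (n : nat) (a b : nat -> 'cV[R]_n) (j : nat)
    : 'cV[R]_n :=
  if odd j then b j./2 else a j./2.

Definition seqE (R : realType) (n : nat) (a b : nat -> 'cV[R]_n) (j : nat)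
    : 'M[R]_n :=
  if odd j then b j./2 *m (b j./2)^T else - (a j./2 *m (a j./2)^T).

Definition seqC (R : realType) (n : nat) (gamma sigma : R)
    (a b : nat -> 'cV[R]_n) (j : nat) : 'M[R]_n :=
  (gamma^-1 + sigma)%:M + \sum_(i < j) seqE a b i.

(* [invmx A] is [A] itself when [A] is singular, so the inverses below are
   meaningful only once [seqC gamma sigma a b j] is known to be in [unitmx]. *)
Definition seqp (R : realType) (n : nat) (gamma sigma : R)
    (a b : nat -> 'cV[R]_n) (j : nat) : 'cV[R]_n :=
  invmx (seqC gamma sigma a b j) *m seqc a b j.

Definition denv (R : realType) (n : nat) (gamma sigma : R)
    (a b : nat -> 'cV[R]_n) (j : nat) : R :=
  if odd j then 1 + dotv (seqp gamma sigma a b j) (b j./2)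
  else 1 - dotv (seqp gamma sigma a b j) (a j./2).

Definition seqv (R : realType) (n : nat) (gamma sigma : R)
    (a b : nat -> 'cV[R]_n) (j : nat) : R :=
  1 / denv gamma sigma a b j.

(* Main.v *)
Require Import Defs.
From mathcomp Require Import all_boot all_order all_algebra.
From mathcomp Require Import reals.
From mathcomp Require Import ring.

Set Implicit Arguments.
Unset Strict Implicit.
Unset Printing Implicit Defensive.

Import Order.TTheory GRing.Theory Num.Theory.
Local Open Scope ring_scope.

(** Each step from [C_j] to [C_(j+1)] adds a signed rank-one matrix
    [(-1)^(j+1) c_j c_j^T], so the inverse is updated by the Sherman-Morrison
    formula ([rank1_update_inv]); telescoping these updates from [C_0] gives the
    formula for [C_(m+1)^-1 z], and the recursion for [p_m] is the same telescoped
    formula for [C_m^-1], applied to [c_m].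

    What has to be proved is that no step degenerates.  The matrix at an even
    index is [C_(2i) = B_i + sigma I], which is positive definite.  At an odd
    index it is [C_(2i+1) = (B_i - a_i a_i^T) + sigma I]; by the Cauchy-Schwarz
    inequality for the inner product of [B_i] ([posdef_cauchy_schwarz]),
    subtracting [a_i a_i^T] leaves a positive semidefinite matrix, and the shift
    by [sigma > 0] makes it positive definite ([seqC_posdef]).  The
    denominators [1 -+ p_j^T c_j] are then nonzero because [C_j] and [C_(j+1)] are
    both invertible ([rank1_update_den_neq0]). *)

(** * Inner product and positive definite matrices *)

Section Dotv.
Variables (R : realType) (n : nat).
Implicit Types (u v w x : 'cV[R]_n) (A : 'M[R]_n).

Lemma dotvC u v : dotv u v = dotv v u.
Proof.
by rewrite /dotv -[in LHS](trmxK v) -trmx_mul mxE.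
Qed.

Lemma dotvDr u v w : dotv u (v + w) = dotv u v + dotv u w.
Proof. by rewrite /dotv mulmxDr mxE. Qed.

Lemma dotvZr u e v : dotv u (e *: v) = e * dotv u v.
Proof. by rewrite /dotv -scalemxAr mxE. Qed.

Lemma dotvDl u v w : dotv (u + v) w = dotv u w + dotv v w.
Proof. by rewrite ![dotv _ w]dotvC dotvDr. Qed.

Lemma dotvZl u e v : dotv (e *: u) v = e * dotv u v.
Proof. by rewrite ![dotv _ v]dotvC dotvZr. Qed.

Lemma dotv_mulmxl A u v : dotv (A *m u) v = dotv u (A^T *m v).
Proof. by rewrite /dotv trmx_mul mulmxA. Qed.

Lemma outer_mul u x : (u *m u^T) *m x = dotv u x *: u.
Proof. by rewrite -mulmxA [u^T *m x]mx11_scalar mul_mx_scalar. Qed.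

Lemma dotv_gt0 x : x != 0 -> 0 < dotv x x.
Proof.
have xxE : dotv x x = \sum_i x i 0 ^+ 2.
  by rewrite /dotv mxE; apply: eq_bigr => i _; rewrite mxE expr2.
move=> x_neq0; rewrite xxE lt0r sumr_ge0 ?andbT => [|i _]; last exact: sqr_ge0.
apply: contra_neq x_neq0 => /eqP; rewrite psumr_eq0 => [/allP sq0|i _]; last first.
  exact: sqr_ge0.
apply/matrixP => i j; rewrite ord1 mxE; apply/eqP.
by rewrite -sqrf_eq0; apply: sq0; rewrite mem_index_enum.
Qed.

Lemma posdef_ker A x : posdef A -> A *m x = 0 -> x = 0.
Proof.
case=> _ Apos Ax0; apply/eqP/negPn/negP => /Apos.
by rewrite Ax0 /dotv mulmx0 mxE ltxx.
Qed.

Lemma posdef_unitmx A : posdef A -> A \in unitmx.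
Proof.
move=> Apd; rewrite -unitmx_tr -row_free_unit -kermx_eq0; apply/eqP/row_matrixP => i.
rewrite row0; apply: trmx_inj; rewrite trmx0; apply: (posdef_ker Apd).
by apply: trmx_inj; rewrite trmx_mul trmxK -row_mul mulmx_ker row0 trmx0.
Qed.

Lemma posdef_ge0 A x : posdef A -> 0 <= dotv x (A *m x).
Proof.
case=> _ Apos; have [->|/Apos/ltW//] := eqVneq x 0.
by rewrite mulmx0 /dotv mulmx0 mxE.
Qed.

(** The component of [x] that is orthogonal to [s] for the inner product of [A]
    has nonnegative norm. *)
Lemma posdef_cauchy_schwarz A s x : posdef A -> s != 0 ->
  dotv (A *m s) x ^+ 2 / dotv s (A *m s) <= dotv x (A *m x).
Proof.
move=> Apd s_neq0; have [Asym Apos] := Apd.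
set q := dotv s (A *m s); set t := dotv (A *m s) x.
have q_neq0 : q != 0 by rewrite gt_eqF ?Apos.
have xAs : dotv x (A *m s) = t by rewrite dotvC.
have sAx : dotv s (A *m x) = t by rewrite /t dotv_mulmxl Asym.
rewrite -subr_ge0.
suff -> : dotv x (A *m x) - t ^+ 2 / q
    = dotv (x + (- (t / q)) *: s) (A *m (x + (- (t / q)) *: s)).
  exact: posdef_ge0.
rewrite mulmxDr -scalemxAr !(dotvDl, dotvDr, dotvZl, dotvZr) xAs sAx -/q.
by field.
Qed.

Lemma posdef_shift A sigma : A^T = A -> (forall x, 0 <= dotv x (A *m x)) ->
  0 < sigma -> posdef (A + sigma%:M).
Proof.
move=> Asym Age0 sigma_gt0; split=> [|x x_neq0].
  by rewrite linearD /= Asym tr_scalar_mx.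
rewrite mulmxDl mul_scalar_mx dotvDr dotvZr ltr_wpDl ?Age0 //.
by rewrite mulr_gt0 ?dotv_gt0.
Qed.

End Dotv.

(** * Rank-one updates *)

Section RankOneUpdate.
Variables (R : realType) (n : nat) (A A' : 'M[R]_n) (c : 'cV[R]_n) (e : R).
Hypothesis (A'E : A' = A + e *: (c *m c^T)).
Hypothesis (A_unit : A \in unitmx) (A'_unit : A' \in unitmx).
Let p := invmx A *m c.

(** The new matrix sends [p] to a multiple of [c], and the multiplier is the
    Sherman-Morrison denominator. *)
Lemma rank1_update_mul_p : A' *m p = (1 + e * dotv p c) *: c.
Proof.
rewrite A'E mulmxDl -scalemxAl outer_mul /p mulKVmx // -/p.
by rewrite scalerDl scale1r scalerA [dotv p c]dotvC.
Qed.

(** A vanishing denominator would give [p] in the kernel of the new matrix, hence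
    [p = 0], for which the denominator is [1]. *)
Lemma rank1_update_den_neq0 : 1 + e * dotv p c != 0.
Proof.
apply/eqP => den0; move: rank1_update_mul_p; rewrite den0 scale0r => A'p0.
have p0 : p = 0 by rewrite -(mulKmx A'_unit p) A'p0 mulmx0.
move: den0; rewrite p0 /dotv trmx0 mul0mx mxE mulr0 addr0.
by move/eqP; rewrite oner_eq0.
Qed.

Lemma rank1_update_inv (z : 'cV[R]_n) : A^T = A ->
  invmx A' *m z = invmx A *m z - (e / (1 + e * dotv p c) * dotv p z) *: p.
Proof.
move=> Asym; apply: (can_inj (mulKmx A'_unit)); rewrite mulKVmx //.
rewrite mulmxBr -scalemxAr rank1_update_mul_p scalerA mulrAC divfK ?rank1_update_den_neq0 //.
rewrite A'E mulmxDl -scalemxAl outer_mul mulKVmx // scalerA.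
(* symmetry of [A] identifies the two inner products *)
have -> : dotv p z = dotv c (invmx A *m z) by rewrite dotv_mulmxl trmx_inv Asym.
by rewrite addrK.
Qed.

End RankOneUpdate.

(** * The matrices C_j *)

Section SeqC.
Variables (R : realType) (n : nat) (gamma sigma : R) (a b : nat -> 'cV[R]_n).
Local Notation C := (seqC gamma sigma a b).
Local Notation c := (seqc a b).
Local Notation p := (seqp gamma sigma a b).
Local Notation v := (seqv gamma sigma a b).

(** Even and odd steps in one form, which makes a single Sherman-Morrison update
    cover both. *)
Lemma seqEE j : seqE a b j = (-1) ^+ j.+1 *: (c j *m (c j)^T).
Proof.
rewrite /seqE /seqc -signr_odd /=; case: (odd j); first by rewrite scale1r.
by rewrite scaleN1r.
Qed.

Lemma denvE j : denv gamma sigma a b j = 1 + (-1) ^+ j.+1 * dotv (p j) (c j).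
Proof.
rewrite /denv /seqc -signr_odd /=; case: (odd j); first by rewrite mul1r.
by rewrite mulN1r.
Qed.

Lemma seqC0 : C 0 = (gamma^-1 + sigma)%:M.
Proof. by rewrite /seqC big_ord0 addr0. Qed.

Lemma seqCS j : C j.+1 = C j + (-1) ^+ j.+1 *: (c j *m (c j)^T).
Proof. by rewrite /seqC big_ord_recr /= addrA seqEE. Qed.

Lemma seqC_double i : C (2 * i) = (gamma^-1)%:M
  - \sum_(l < i) a l *m (a l)^T + \sum_(l < i) b l *m (b l)^T + sigma%:M.
Proof.
elim: i => [|i IHi].
  by rewrite seqC0 !big_ord0 subr0 addr0 raddfD.
rewrite mulnS -[(2 + 2 * i)%N]/(2 * i).+2 !seqCS IHi !big_ord_recr /=.
rewrite /seqc /= mul2n odd_double /= uphalf_double doubleK.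
rewrite -(signr_odd _ _.+2) -(signr_odd _ _.+1) /= odd_double /= scaleN1r scale1r.
by rewrite opprD !addrA [LHS](ACl (1*2*5*3*6*4)).
Qed.

Variable N : nat.
Hypothesis C_posdef : forall j, (j <= N)%N -> posdef (C j).

Lemma seqC_denv_neq0 j : (j < N)%N -> denv gamma sigma a b j != 0.
Proof.
move=> ltjN; rewrite denvE; apply: (rank1_update_den_neq0 (seqCS j)).
  exact/posdef_unitmx/C_posdef/ltnW.
exact/posdef_unitmx/C_posdef.
Qed.

Lemma invmx_seqC m z : (m <= N)%N ->
  invmx (C m) *m z = invmx (C 0) *m z
    + \sum_(i < m) ((-1) ^+ i * v i * dotv (p i) z) *: p i.
Proof.
elim: m => [|m IHm] ltmN; first by rewrite big_ord0 addr0.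
have Cm_pd := C_posdef (ltnW ltmN).
have [Cm_sym _] := Cm_pd.
rewrite (rank1_update_inv (seqCS m) (posdef_unitmx Cm_pd)
           (posdef_unitmx (C_posdef ltmN)) _ Cm_sym).
rewrite IHm ?(ltnW ltmN) // big_ord_recr /= addrA; congr (_ + _).
by rewrite -scaleNr /seqv denvE div1r exprS mulN1r !mulNr opprK.
Qed.

End SeqC.

(** * Positive definiteness along the L-BFGS updates *)

Section LBFGS.
Variables (R : realType) (n k : nat) (gamma sigma : R).
Variables (s y : nat -> 'cV[R]_n) (B : nat -> 'M[R]_n).
Hypothesis (sigma_gt0 : 0 < sigma) (B_lbfgs : lbfgs_matrices k gamma s y B).
Hypothesis (s_neq0 : forall i : nat, (i < k)%N -> s i != 0).
Hypothesis (B_posdef : forall j : nat, (j <= k)%N -> posdef (B j)).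
Local Notation a := (lbfgs_a B s).
Local Notation b := (lbfgs_b s y).
Local Notation C := (seqC gamma sigma a b).

Lemma seqC_even i : (i <= k)%N -> C (2 * i) = B i + sigma%:M.
Proof.
case: B_lbfgs => B0 BE leik; rewrite seqC_double; congr (_ + _).
case: i leik => [|i] leik; first by rewrite !big_ord0 subr0 addr0 B0.
by rewrite BE // B0.
Qed.

Lemma lbfgs_sub_a_ge0 i x : (i < k)%N ->
  0 <= dotv x ((B i - a i *m (a i)^T) *m x).
Proof.
move=> ltik; have Bpd := B_posdef (ltnW ltik).
rewrite mulmxBl outer_mul -scaleNr dotvDr dotvZr mulNr subr_ge0.
apply: le_trans (posdef_cauchy_schwarz x Bpd (s_neq0 ltik)).
rewrite [dotv x _]dotvC -expr2 /lbfgs_a dotvZl exprMn exprVn mulrC.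
by rewrite sqr_sqrtr // posdef_ge0.
Qed.

Lemma seqC_posdef j : (j <= 2 * k)%N -> posdef (C j).
Proof.
rewrite -(odd_double_half j) -mul2n; set i := j./2.
case: (odd j) => /=; last first.
  rewrite add0n leq_pmul2l // => leik; rewrite seqC_even //.
  have Bpd := B_posdef leik.
  by apply: posdef_shift => // [|x]; [case: Bpd | exact: posdef_ge0].
rewrite add1n ltn_pmul2l // => ltik.
have -> : C (2 * i).+1 = (B i - a i *m (a i)^T) + sigma%:M.
  rewrite seqCS seqC_even ?(ltnW ltik) // /seqc -signr_odd /= mul2n odd_double.
  by rewrite doubleK scaleN1r addrAC.
apply: posdef_shift => // [|x]; last exact: lbfgs_sub_a_ge0.
have [Bsym _] := B_posdef (ltnW ltik).
by rewrite linearB /= trmx_mul trmxK Bsym.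
Qed.

End LBFGS.

Theorem mainTheorem2 (R : realType) (n k : nat) (gamma sigma eps : R)
    (s y : nat -> 'cV[R]_n) (B : nat -> 'M[R]_n)
    (k_ge1 : (1 <= k)%N)
    (gamma_gt0 : 0 < gamma) (sigma_gt0 : 0 < sigma)
    (eps_gt0 : 0 < eps) (eps_lt : eps < gamma * sigma)
    (B_lbfgs : lbfgs_matrices k gamma s y B)
    (s_neq0 : forall i : nat, (i < k)%N -> s i != 0)
    (ys_gt0 : forall i : nat, (i < k)%N -> 0 < dotv (y i) (s i))
    (B_posdef : forall j : nat, (j <= k)%N -> posdef (B j)) :
  let a := lbfgs_a B s in
  let b := lbfgs_b s y in
  let C := seqC gamma sigma a b in
  let c := seqc a b in
  let p := seqp gamma sigma a b in
  let v := seqv gamma sigma a b in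
  [/\ (* the inverses and quotients involved exist *)
      forall j : nat, (j <= 2 * k)%N -> C j \in unitmx,
      forall j : nat, (j < 2 * k)%N -> denv gamma sigma a b j != 0,
      C (2 * k)%N = B k + sigma%:M,
      forall (z : 'cV[R]_n) (m : nat), (m < 2 * k)%N ->
        invmx (C m.+1) *m z =
          invmx (C 0%N) *m z
          + \sum_(i < m.+1) ((-1) ^+ i * v i * dotv (p i) z) *: p i
        /\ invmx (C 0%N) *m z = (gamma^-1 + sigma)^-1 *: z
    & forall m : nat, (m < 2 * k)%N ->
        p m = invmx (C 0%N) *m c m
              + \sum_(i < m) ((-1) ^+ i * v i * dotv (p i) (c m)) *: p i].
Proof.
move=> a b C c p v.
have C_pd : forall j, (j <= 2 * k)%N -> posdef (C j).
  exact: (seqC_posdef sigma_gt0 B_lbfgs s_neq0 B_posdef).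
split.
- by move=> j /C_pd/posdef_unitmx.
- exact: (seqC_denv_neq0 C_pd).
- exact: (seqC_even _ B_lbfgs).
- move=> z m ltm; split; first exact: (invmx_seqC C_pd).
  by rewrite /C seqC0 invmx_scalar mul_scalar_mx.
- by move=> m ltm; apply: (invmx_seqC C_pd); apply: ltnW.
Qed.
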